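(* Let $E$ be a finite set, $S=\mathbb{C}[x_e:e\in E]$, and let $I\subset S$ be a standard-homogeneous ideal not containing the irrelevant ideal. For $w\in\mathbb{R}^E$, let $$I^w=\bigcap_{\Delta}\widetilde I^\Delta,$$ where $\Delta$ runs over the cells of $\operatorname{subd}_{-w}\mathcal A(I)$, and $\widetilde I^\Delta$ is the ideal of $S$ generated by $I\cap\mathbb{C}[\Delta]$ and all $x_e$ with $a_e\notin\Delta$. Then the set $$\Omega^*(I)=\{w\in\mathbb{R}^E: I^w=\operatorname{in}_wI\}$$ is the support of a subfan of $-\operatorname{Sec}\mathcal A(I)$, the fan obtained from $\operatorname{Sec}\mathcal A(I)$ by the reflection $w\mapsto -w$.
   Context: $\operatorname{in}_w p$ is the sum of the terms of $p$ of minimal $w$-weight, and $\operatorname{in}_wI$ is the ideal generated by all $\operatorname{in}_w p$, $p\in I$. $\mathcal L(I)=\{w:\operatorname{in}_wI=I\}$. $\mathcal A(I)=(a_e)_{e\in E}\subset\mathcal L(I)^*$, where $a_e$ is the restriction of the $e$-th coordinate functional to $\mathcal L(I)$. For a point configuration $A=(a_e)$ in $V$ and $u\in\mathbb{R}^E$, $\operatorname{subd}_uA$ is the set of cells $(a_e)_{e\in E_f}$, for $f\in V^*$, where $E_f$ is the set of $e$ minimizing $f(a_e)+u_e$. $\mathbb{C}[\Delta]=\mathbb{C}[x_e:a_e\in\Delta]$. For a regular subdivision $\Theta$ of $A$, let $\operatorname{cone}(A,\Theta)$ be the closure of $\{u:\operatorname{subd}_uA=\Theta\}$. The secondary fan $\operatorname{Sec}A$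 is the complete fan whose cones are these $\operatorname{cone}(A,\Theta)$. *)

(* Defs.v *)
From HB Require Import structures.
From mathcomp Require Import all_boot all_order all_algebra.
From mathcomp Require Import boolp classical_sets functions cardinality reals.
From mathcomp Require Import topology.
From mathcomp Require Import complex mpoly.

Set Implicit Arguments.
Unset Strict Implicit.
Unset Printing Implicit Defensive.

Import Order.TTheory GRing.Theory Num.Theory.
Import numFieldTopology.Exports.

Local Open Scope classical_set_scope.
Local Open Scope ring_scope.

(* Conventions: E is the index set 'I_n, weights w in R^E are row vectors
   'rV[R]_n, and S = C[x_e : e in E] is {mpoly R[i][n]}.                      *)

Section Ideals.
Variable A : comNzRingType.
Implicit Types (I J G : set A).

(* The unit ideal is allowed. *)
Definition is_ideal J : Prop :=
  [/\ J 0, (forall p q, J p -> J q -> J (p + q)) &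
      (forall a p, J p -> J (a * p))].

Definition ideal_gen G : set A := smallest is_ideal G.

Lemma ideal_gen_ideal G : is_ideal (ideal_gen G).
Proof.
split.
- by move=> J [[]].
- by move=> p q Ip Iq J JG; case: (JG) => -[_ JD _] _; exact: JD (Ip _ JG) (Iq _ JG).
- by move=> a p Ip J JG; case: (JG) => -[_ _ JM] _; exact: JM (Ip _ JG).
Qed.

End Ideals.

Section PolynomialIdeals.
Variables (K : comNzRingType) (n : nat).
Implicit Types (p : {mpoly K[n]}) (I : set {mpoly K[n]}).

Definition irrelevant_ideal : set {mpoly K[n]} :=
  ideal_gen [set 'X_e | e in [set: 'I_n]].

Definition std_homogeneous I : Prop :=
  forall p, I p -> forall d, I (pihomog mdeg d p).

(* The polynomial subring on the variables x_e with e in D. *)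
Definition subring_on (D : {set 'I_n}) : set {mpoly K[n]} :=
  [set p | forall m, m \in msupp p -> forall e, e \notin D -> m e = 0%N].

Definition cell_ideal I (D : {set 'I_n}) : set {mpoly K[n]} :=
  ideal_gen ((I `&` subring_on D) `|` [set 'X_e | e in [set e | e \notin D]]).

End PolynomialIdeals.

Arguments irrelevant_ideal : clear implicits.

Section InitialIdeals.
Variables (R : realType) (n : nat).
Local Notation S := {mpoly R[i][n]}.
Implicit Types (w : 'rV[R]_n) (m : 'X_{1..n}) (p : S) (I : set S).

Definition mweight w m : R := \sum_(e < n) w 0 e *+ m e.

Definition initial w p : S :=
  \sum_(m <- msupp p | all (fun m' => mweight w m <= mweight w m') (msupp p))
     p@_m *: 'X_[m].

Definition initial_ideal w I : set S := ideal_gen [set initial w p | p in I].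

Definition lineality I : set 'rV[R]_n := [set w | initial_ideal w I = I].

(* The space [lineality I] as an object of type {vspace _}; the two agree for
   every ideal I, see [mem_lineality_vspace]. *)
Definition lineality_vspace I : {vspace 'rV[R]_n} :=
  xget 0%VS [set U : {vspace 'rV[R]_n} | forall w, w \in U <-> lineality I w].

Definition mwcomp w (c : R) p : S :=
  \sum_(m <- msupp p | mweight w m == c) p@_m *: 'X_[m].

Lemma mcoeff_filter (P : pred 'X_{1..n}) p m :
  (\sum_(m' <- msupp p | P m') p@_m' *: 'X_[m'])@_m = if P m then p@_m else 0.
Proof.
rewrite raddf_sum /= big_mkcond /=.
have [mp|mp] := boolP (m \in msupp p).
  rewrite (bigD1_seq m) ?msupp_uniq //= big1 ?addr0.
    by rewrite mcoeffZ mcoeffX eqxx mulr1.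
  move=> m' nm; case: ifP => // _.
  by rewrite mcoeffZ mcoeffX (negPf nm) mulr0.
rewrite (memN_msupp_eq0 mp) if_same big_seq big1 // => m' m'p.
case: ifP => // _; rewrite mcoeffZ mcoeffX.
by case: eqP => [e|]; [rewrite -e m'p in mp | rewrite mulr0].
Qed.

Lemma mwcompE w c p m :
  (mwcomp w c p)@_m = if mweight w m == c then p@_m else 0.
Proof. exact: mcoeff_filter. Qed.

Lemma initialE w p m :
  (initial w p)@_m =
  if all (fun m' => mweight w m <= mweight w m') (msupp p) then p@_m else 0.
Proof.
exact: (mcoeff_filter
  (fun m => all (fun m' => mweight w m <= mweight w m') (msupp p))).
Qed.

Lemma mweightD w v m : mweight (w + v) m = mweight w m + mweight v m.
Proof.
by rewrite -big_split; apply: eq_bigr => e _; rewrite mxE mulrnDl.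
Qed.

Lemma mweightZ k w m : mweight (k *: w) m = k * mweight w m.
Proof. by rewrite mulr_sumr; apply: eq_bigr => e _; rewrite mxE mulrnAr. Qed.

Lemma mweight0 m : mweight 0 m = 0.
Proof. by apply: big1 => e _; rewrite mxE mul0rn. Qed.

Lemma ideal_sum I (T : eqType) (r : seq T) (F : T -> S) :
  is_ideal I -> (forall i, i \in r -> I (F i)) -> I (\sum_(i <- r) F i).
Proof.
move=> [I0 ID _] FI; rewrite big_seq; elim/big_rec: _ => // i p ir Ip.
by apply: ID => //; exact: FI.
Qed.

Lemma mwcomp_sum w p :
  p = \sum_(c <- undup [seq mweight w m | m <- msupp p]) mwcomp w c p.
Proof.
apply/mpolyP => m; rewrite raddf_sum /=.
have [mp|mp] := boolP (m \in msupp p); last first.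
  by rewrite (memN_msupp_eq0 mp) big1 // => c _; rewrite mwcompE memN_msupp_eq0 ?if_same.
rewrite (bigD1_seq (mweight w m)) ?undup_uniq //=; last first.
  by rewrite mem_undup map_f.
rewrite mwcompE eqxx big1 ?addr0 // => c nc.
by rewrite mwcompE eq_sym (negPf nc).
Qed.

Lemma initial_mwcomp w p : p != 0 ->
  exists2 m, m \in msupp p & initial w p = mwcomp w (mweight w m) p.
Proof.
rewrite -msupp_eq0 => p0.
have [m mp mmin] : exists2 m, m \in msupp p &
    forall m', m' \in msupp p -> mweight w m <= mweight w m'.
  elim: (msupp p) p0 => // a s IH _.
  have [->|s0] := eqVneq s [::].
    by exists a; rewrite ?mem_head // => m'; rewrite inE => /eqP->.
  have [b bs bmin] := IH s0.
  have [ab|ba] := leP (mweight w a) (mweight w b).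
    exists a; rewrite ?mem_head // => m'; rewrite inE => /orP[/eqP->//|].
    by move=> /bmin; exact: le_trans.
  exists b; first by rewrite inE bs orbT.
  by move=> m'; rewrite inE => /orP[/eqP->|/bmin//]; exact: ltW.
exists m => //; apply/mpolyP => m1; rewrite initialE mwcompE.
have [m1p|m1p] := boolP (m1 \in msupp p); last first.
  by rewrite memN_msupp_eq0 ?if_same.
congr (if _ then _ else _); apply/allP/eqP => [H|-> //].
by apply/le_anti; rewrite H //= mmin.
Qed.

(* L(I) consists of the weights for which I is homogeneous. *)
Lemma linealityE I w : is_ideal I ->
  lineality I w <-> (forall p, I p -> forall c, I (mwcomp w c p)).
Proof.
move=> Iid; split => [LI | HI].
  move=> p; have [k] := ubnP (size (msupp p)).
  elim: k p => // k IH p; rewrite ltnS => pk Ip c.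
  have [p0|p0] := eqVneq p 0.
    suff -> : mwcomp w c p = 0 by case: Iid.
    by rewrite /mwcomp p0 msupp0 big_nil.
  have [m mp initE] := initial_mwcomp w p0.
  have Iin : I (initial w p).
    by rewrite -LI; apply: sub_gen_smallest; exists p.
  have [I0 ID IM] := Iid.
  set q := p - initial w p.
  have Iq : I q by apply: ID => //; rewrite -mulN1r; exact: IM.
  have qE m' : q@_m' = if mweight w m' == mweight w m then 0 else p@_m'.
    by rewrite mcoeffB initE mwcompE; case: ifP; rewrite ?subrr ?subr0.
  have qk : (size (msupp q) < k)%N.
    apply: leq_trans pk; rewrite (perm_size (perm_to_rem mp)) /= ltnS.
    apply: uniq_leq_size; first exact: msupp_uniq.
    move=> m'; rewrite mem_rem_uniq ?msupp_uniq // !inE !mcoeff_msupp qE.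
    by have [->|] := eqVneq m' m; [rewrite eqxx eqxx | case: ifP; rewrite ?eqxx].
  have -> : mwcomp w c p =
      mwcomp w c q + (if c == mweight w m then initial w p else 0).
    apply/mpolyP => m'; rewrite mcoeffD !mwcompE qE.
    have [->|nc] := eqVneq c (mweight w m).
      by rewrite initE mwcompE; case: ifP; rewrite ?add0r ?addr0.
    rewrite mcoeff0 addr0; case: ifP => // /eqP->.
    by rewrite (negPf nc).
  by apply: ID; [exact: IH | case: ifP].
apply/seteqP; split.
  apply: smallest_sub => // _ [p Ip <-].
  have [->|p0] := eqVneq p 0.
    by rewrite /initial msupp0 big_nil; case: Iid.
  by have [m _ ->] := initial_mwcomp w p0; exact: HI.
move=> p Ip; rewrite (mwcomp_sum w p).
apply: ideal_sum; first exact: ideal_gen_ideal.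
move=> c _; apply: sub_gen_smallest; exists (mwcomp w c p); first exact: HI.
apply/mpolyP => m; rewrite initialE; case: ifP => // /negbT/allPn[m' m'c].
have [mc|mc] := boolP (m \in msupp (mwcomp w c p)); last first.
  by rewrite memN_msupp_eq0.
suff H x : x \in msupp (mwcomp w c p) -> mweight w x = c by rewrite !H // lexx.
by rewrite mcoeff_msupp mwcompE; case: (_ =P c) => // _; rewrite eqxx.
Qed.

Lemma lineality_linear I : is_ideal I -> lineality I 0 /\
  forall k w v, lineality I w -> lineality I v -> lineality I (k *: w + v).
Proof.
move=> Iid; split.
  apply/linealityE => // p Ip c.
  have -> : mwcomp 0 c p = if c == 0 then p else 0.
    apply/mpolyP => m; rewrite mwcompE mweight0 eq_sym.
    by case: ifP => // _; rewrite mcoeff0.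
  by case: ifP => // _; case: Iid.
move=> k w v /(linealityE _ Iid) Lw /(linealityE _ Iid) Lv.
apply/linealityE => // p Ip c.
rewrite (_ : mwcomp _ _ _ =
    \sum_(a <- undup [seq mweight w m | m <- msupp p])
      mwcomp v (c - k * a) (mwcomp w a p)).
  by apply: ideal_sum => // a _; apply: Lv; exact: Lw.
apply/mpolyP => m; rewrite mwcompE raddf_sum /=.
have [mp|mp] := boolP (m \in msupp p); last first.
  rewrite (memN_msupp_eq0 mp) if_same big1 // => a _.
  by rewrite !mwcompE memN_msupp_eq0 // !if_same.
rewrite (bigD1_seq (mweight w m)) ?undup_uniq //=; last first.
  by rewrite mem_undup map_f.
rewrite !mwcompE eqxx big1 ?addr0; last first.
  by move=> a na; rewrite !mwcompE [mweight w m == a]eq_sym (negPf na) if_same.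
congr (if _ then _ else _).
by rewrite mweightD mweightZ eq_sym [RHS]eq_sym subr_eq addrC.
Qed.

Lemma mem_lineality_vspace I w : is_ideal I ->
  w \in lineality_vspace I <-> lineality I w.
Proof.
move=> Iid; have [L0 LP] := lineality_linear Iid.
suff [U HU] : exists U : {vspace 'rV[R]_n}, forall w, w \in U <-> lineality I w.
  by rewrite /lineality_vspace; case: xgetP => [U' _ ->//|/(_ U)]; case.
apply: contrapT => noU.
have grow k : exists2 U : {vspace 'rV[R]_n},
    (k <= \dim U)%N & forall v, v \in U -> lineality I v.
  elim: k => [|k [U kU UL]].
    by exists 0%VS => // v; rewrite memv0 => /eqP->.
  have [v Lv vU] : exists2 v, lineality I v & v \notin U.
    apply: contrapT => H; apply: noU; exists U => v; split; first exact: UL.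
    by move=> Lv; apply: contrapT => /negP vU; apply: H; exists v.
  exists (<[v]> + U)%VS; last first.
    move=> x /memv_addP[_ /vlineP[a ->] [y yU ->]].
    by apply: LP => //; exact: UL.
  apply: leq_ltn_trans kU _; rewrite (ltn_leqif (dimv_leqif_sup (addvSr _ _))).
  by apply: contra vU => /subvP; apply; apply: (subvP (addvSl _ _)); exact: memv_line.
have [U + _] := grow (\dim {: 'rV[R]_n}).+1.
by rewrite ltnNge dimvS ?subvf.
Qed.

End InitialIdeals.

Section Subdivisions.
Variables (R : realType) (n : nat) (V : vectType R) (a : 'I_n -> V).
Implicit Types (u : 'rV[R]_n) (f : 'Hom(V, R^o)).
Implicit Types Theta : set {set 'I_n}.

(* Configurations are labelled, so a cell (a_e)_{e in D} is encoded by the set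
   of labels D; distinct labels may carry the same point. *)
Definition cell u f : {set 'I_n} :=
  [set e : 'I_n |
    [forall e' : 'I_n, (f (a e) : R) + u 0 e <= (f (a e') : R) + u 0 e']]%SET.

Definition subd u : set {set 'I_n} := range (cell u).

Definition regular_subdivision Theta : Prop := exists u, subd u = Theta.

Definition secondary_cone Theta : set 'rV[R]_n :=
  closure [set u | subd u = Theta].

Definition secondary_fan : set (set 'rV[R]_n) :=
  [set secondary_cone Theta | Theta in regular_subdivision].

End Subdivisions.

Section Fans.
Variables (R : realType) (V : vectType R).
Implicit Types (C F : set V) (Phi Psi : set (set V)).

Definition polyhedral_cone C : Prop :=
  exists s : seq 'Hom(V, R^o),
    C = [set x | forall phi, phi \in s -> 0 <= (phi x : R)].

(* These are the nonempty faces of a polyhedral cone, C itself included. *)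
Definition is_face F C : Prop :=
  exists phi : 'Hom(V, R^o),
    (forall x, C x -> 0 <= (phi x : R)) /\ F = C `&` [set x | phi x = 0].

Definition is_fan Phi : Prop :=
  [/\ finite_set Phi,
      forall C, Phi C -> polyhedral_cone C,
      forall C F, Phi C -> is_face F C -> Phi F &
      forall C C', Phi C -> Phi C' ->
        is_face (C `&` C') C /\ is_face (C `&` C') C'].

Definition subfan Psi Phi : Prop := Psi `<=` Phi /\ is_fan Psi.

Definition fan_support Phi : set V := \bigcup_(C in Phi) C.

Definition opp_fan Phi : set (set V) := [set -%R @` C | C in Phi].

End Fans.

Section Main.
Variables (R : realType) (n : nat).
Implicit Types (w : 'rV[R]_n) (I : set {mpoly R[i][n]}).

(* The configuration A(I) in the dual space of L(I). *)
Definition lineality_config I (e : 'I_n) :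
    'Hom(subvs_of (lineality_vspace I), R^o) :=
  linfun (fun l : subvs_of (lineality_vspace I) =>
    (vsval l : 'rV[R]_n) 0 e : R^o).

Lemma lineality_configE I e (l : subvs_of (lineality_vspace I)) :
  lineality_config I e l = (vsval l : 'rV[R]_n) 0 e.
Proof.
pose g (l : subvs_of (lineality_vspace I)) : R^o := (vsval l : 'rV[R]_n) 0 e.
have g_lin : linear g by move=> k x y; rewrite /g linearP /= !mxE.
pose gL := GRing.isLinear.Build _ _ _ _ g g_lin.
pose gl : {linear _ -> _} := HB.pack g gL.
exact: (lfunE gl l).
Qed.

Definition subd_ideal I w : set {mpoly R[i][n]} :=
  \bigcap_(D in subd (lineality_config I) (- w)) cell_ideal I D.

Definition Omega_star I : set 'rV[R]_n :=
  [set w | subd_ideal I w = initial_ideal w I].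

End Main.

(* Main.v *)
From HB Require Import structures.
Require Import Defs.
From mathcomp Require Import all_boot all_order all_algebra.
From mathcomp Require Import boolp classical_sets functions cardinality reals.
From mathcomp Require Import topology.
From mathcomp Require Import complex mpoly.
From mathcomp Require Import ring lra.
(* [mpoly] has a [mweight] of its own. *)
Import Defs.

(* Write L for the lineality space of I; cells of the subdivision induced by
   u = -w are the sets where some l + u, l in L, is minimal.

   Algebra.  I is graded by L^*.  Within one degree, the monomials supported on
   cells all lie in a common cell, and they are exactly the monomials of maximal
   w-weight.  Hence in_w I is always contained in I^w, with equality if and only
   if every monomial not supported on a cell lies in in_w I.  When equality
   holds, repeated rewriting by terms of higher weight reduces such a monomial
   modulo I to a polynomial g of the same degree supported on cells.  If the
   subdivision of w refines that of w', then g is supported on cells for w' as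
   well, so the same relation x^m - g puts x^m in in_{w'} I.  Thus the set
   Omega^* is stable under coarsening the subdivision.

   Geometry.  The closure of the u inducing a given subdivision consists of the
   v inducing a coarser one; this is a polyhedral cone by Fourier-Motzkin
   elimination.  If v and v' are both coarser than u then every cell of v + v'
   is contained in a cell of v; this rests on linear programming duality.  It
   follows that each face of a secondary cone, and each intersection of two of
   them, is the secondary cone of any of its points with the finest
   subdivision.  So the cones of the points of Omega^* form a fan. *)

Set Implicit Arguments.
Unset Strict Implicit.
Unset Printing Implicit Defensive.

Import Order.TTheory GRing.Theory Num.Theory.
Import numFieldTopology.Exports.

Local Open Scope classical_set_scope.
Local Open Scope ring_scope.

(** * Homogeneous linear inequalities and their projections *)

Section LinearInequalities.
Variables (R : realFieldType) (n : nat).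
Implicit Types (x y c f : 'rV[R]_n) (s : seq 'rV[R]_n) (W : {vspace 'rV[R]_n}).

Definition dot x y : R := \sum_i x 0 i * y 0 i.

Lemma dotC x y : dot x y = dot y x.
Proof. by apply: eq_bigr => i _; rewrite mulrC. Qed.

Lemma dotDr f x y : dot f (x + y) = dot f x + dot f y.
Proof. by rewrite -big_split; apply: eq_bigr => i _; rewrite mxE mulrDr. Qed.

Lemma dotZr f k x : dot f (k *: x) = k * dot f x.
Proof. by rewrite mulr_sumr; apply: eq_bigr => i _; rewrite mxE mulrCA. Qed.

Lemma dotDl x y f : dot (x + y) f = dot x f + dot y f.
Proof. by rewrite dotC dotDr !(dotC f). Qed.

Lemma dotZl k x f : dot (k *: x) f = k * dot x f.
Proof. by rewrite dotC dotZr dotC. Qed.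

Lemma dotNr f x : dot f (- x) = - dot f x.
Proof. by rewrite -scaleN1r dotZr mulN1r. Qed.

Lemma dot0r f : dot f 0 = 0.
Proof. by rewrite -(scale0r 0) dotZr mul0r. Qed.

Lemma dot_suml (T : Type) (r : seq T) (P : pred T) (F : T -> 'rV[R]_n) x :
  dot (\sum_(i <- r | P i) F i) x = \sum_(i <- r | P i) dot (F i) x.
Proof.
by elim/big_rec2: _ => [|i a b _ <-]; rewrite ?dotDl // dotC dot0r.
Qed.

Lemma dot_delta i x : dot (delta_mx 0 i) x = x 0 i.
Proof.
rewrite /dot (bigD1 i) //= mxE !eqxx mul1r big1 ?addr0 // => j ji.
by rewrite mxE (negPf ji) andbF mul0r.
Qed.

Definition dot_lfun f : 'Hom('rV[R]_n, R^o) := linfun (dot f : 'rV[R]_n -> R^o).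

Lemma dot_lfunE f x : dot_lfun f x = dot f x.
Proof.
have g_lin : linear (dot f : 'rV[R]_n -> R^o).
  by move=> k y z; rewrite dotDr dotZr.
pose gL := GRing.isLinear.Build _ _ _ _ (dot f : 'rV[R]_n -> R^o) g_lin.
pose gl : {linear _ -> _} := HB.pack (dot f : 'rV[R]_n -> R^o) gL.
exact: (lfunE gl x).
Qed.

Lemma exists_argmin (T : eqType) (F : T -> R) (r : seq T) : r != [::] ->
  exists2 a, a \in r & forall b, b \in r -> F a <= F b.
Proof.
elim: r => // a r IH _; have [->|/IH[b br bmin]] := eqVneq r [::].
  by exists a; rewrite ?mem_head // => b; rewrite inE => /eqP->.
have [ab|ba] := leP (F a) (F b).
  exists a; rewrite ?mem_head // => d; rewrite inE => /predU1P[->//|/bmin].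
  exact: le_trans.
exists b; first by rewrite inE br orbT.
by move=> d; rewrite inE => /predU1P[->|/bmin//]; exact: ltW.
Qed.

(** The largest lower bound serves as [t], or the smallest upper bound if there is no lower one.
    This is the multiplier needed to eliminate one direction. *)
Lemma separating_point (lo up : seq R) :
  (forall a b, a \in lo -> b \in up -> a <= b) ->
  exists t, (forall a, a \in lo -> a <= t) /\ (forall b, b \in up -> t <= b).
Proof.
move=> H; have [lo0|/(exists_argmin (@GRing.opp _))[a alo amax]] := eqVneq lo [::].
  have [up0|/(exists_argmin id)[b bup bmin]] := eqVneq up [::].
    by exists 0; rewrite lo0 up0.
  by exists b; rewrite lo0.
exists a; split=> b; first by move/amax; rewrite lerN2.
exact: H.
Qed.

Definition feasible s x := forall f, f \in s -> 0 <= dot f x.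

(** Quantifying over such properties records that eliminated inequalities are nonnegative
    combinations of the old ones, without naming coefficients. *)
Definition conic (Q : 'rV[R]_n -> Prop) :=
  forall a b x y, 0 <= a -> 0 <= b -> Q x -> Q y -> Q (a *: x + b *: y).

(* Fourier-Motzkin elimination of one direction: the new inequalities are the
   nonnegative combinations of at most two old ones that are constant along c. *)
Lemma eliminate_line s c : exists s',
  [/\ forall Q, conic Q -> (forall f, f \in s -> Q f) ->
        forall f, f \in s' -> Q f,
      forall f, f \in s' -> dot f c = 0 &
      forall x, (exists t, feasible s (x + t *: c)) <-> feasible s' x].
Proof.
pose comb p q := dot p c *: q + (- dot q c) *: p.
pose pos := [seq p <- s | 0 < dot p c].
pose neg := [seq q <- s | dot q c < 0].
exists ([seq f <- s | dot f c == 0] ++ [seq comb p q | p <- pos, q <- neg]).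
split.
- move=> Q Qc Qs f; rewrite mem_cat mem_filter => /orP[/andP[_ /Qs//]|].
  case/allpairsP => -[p q] [] /=; rewrite !mem_filter.
  move=> /andP[p0 ps] /andP[q0 qs] ->.
  by apply: Qc; rewrite ?oppr_ge0 ?(ltW p0) ?(ltW q0) //; exact: Qs.
- move=> f; rewrite mem_cat mem_filter => /orP[/andP[/eqP//]|].
  by case/allpairsP => -[p q] [_ _ ->] /=; rewrite dotDl !dotZl; ring.
move=> x; split.
  case=> t Ft f; rewrite mem_cat mem_filter => /orP[/andP[/eqP f0 /Ft]|].
    by rewrite dotDr dotZr f0 mulr0 addr0.
  case/allpairsP => -[p q] [] /=; rewrite !mem_filter.
  move=> /andP[p0 /Ft] + /andP[q0 /Ft] + -> /=.
  by rewrite dotDl !dotZl !dotDr !dotZr; nra.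
move=> F.
have [|t [tlo tup]] := @separating_point [seq - dot p x / dot p c | p <- pos]
    [seq - dot q x / dot q c | q <- neg].
  move=> _ _ /mapP[p pp ->] /mapP[q qn ->].
  have := F (comb p q); rewrite mem_cat orbC allpairs_f // => /(_ isT).
  move: pp qn; rewrite !mem_filter dotDl !dotZl => /andP[p0 _] /andP[q0 _] H.
  rewrite ler_pdivrMr // mulrAC ler_ndivlMr //; nra.
exists t => f fs; rewrite dotDr dotZr.
have [f0|f0|f0] := ltgtP (dot f c) 0.
- have fn : f \in neg by rewrite mem_filter f0.
  by have := tup _ (map_f _ fn); rewrite ler_ndivlMr //; lra.
- have fp : f \in pos by rewrite mem_filter f0.
  by have := tlo _ (map_f _ fp); rewrite ler_pdivrMr //; lra.
by rewrite f0 mulr0 addr0; apply: F; rewrite mem_cat mem_filter f0 eqxx fs.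
Qed.

(** Directions are eliminated one at a time along a basis. Vanishing on a vector is a conic
    property, so later eliminations preserve it. *)
Lemma eliminate_subspace s W : exists s',
  [/\ forall Q, conic Q -> (forall f, f \in s -> Q f) ->
        forall f, f \in s' -> Q f,
      forall f, f \in s' -> forall y, y \in W -> dot f y = 0 &
      forall x, (exists2 y, y \in W & feasible s (x + y)) <-> feasible s' x].
Proof.
rewrite -(span_basis (vbasisP W)); move: (tval _) => {W}.
elim=> [|c X [s1 [s1Q s1X s1P]]].
  exists s; split=> // [f fs y|x]; rewrite span_nil.
    by rewrite memv0 => /eqP->; rewrite dot0r.
  split=> [[y]|Fx]; first by rewrite memv0 => /eqP->; rewrite addr0.
  by exists 0; rewrite ?mem0v ?addr0.
have [s2 [s2Q s2c s2P]] := eliminate_line s1 c.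
exists s2; split.
- by move=> Q Qc Qs; apply: s2Q => //; exact: s1Q.
- move=> f fs2 y; rewrite span_cons => /memv_addP[_ /vlineP[k ->] [z zX ->]].
  rewrite dotDr dotZr s2c // mulr0 add0r.
  apply: (s2Q (fun f => dot f z = 0)) => // [a b g h _ _ g0 h0|g gs1].
    by rewrite dotDl !dotZl g0 h0 !mulr0 addr0.
  exact: s1X.
move=> x; rewrite -s2P; split.
  case=> y; rewrite span_cons => /memv_addP[_ /vlineP[k ->] [z zX ->]] F.
  by exists k; apply/s1P; exists z => //; rewrite -addrA.
case=> k /s1P[z zX F]; exists (k *: c + z); last by rewrite addrA.
by rewrite span_cons memv_add ?memvZ ?memv_line.
Qed.

End LinearInequalities.

(** * Properties of all sufficiently small positive numbers *)

Section Small.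
Variable R : realFieldType.
Implicit Types (P Q : R -> Prop).

Definition small P := exists2 d, 0 < d & forall t, 0 < t <= d -> P t.

Lemma small_ex P : small P -> exists2 t, 0 < t & P t.
Proof. by case=> d d0 H; exists d => //; apply: H; rewrite d0 lexx. Qed.

Lemma small_imp P Q : (forall t, 0 < t -> P t -> Q t) -> small P -> small Q.
Proof. by move=> PQ [d d0 H]; exists d => // t /[dup] /andP[? _] /H; exact: PQ. Qed.

Lemma small_and P Q : small P -> small Q -> small (fun t => P t /\ Q t).
Proof.
move=> [d d0 HP] [e e0 HQ]; exists (Num.min d e); first by rewrite lt_min d0.
by move=> t; rewrite le_min => /and3P[t0 td te]; split; [apply: HP|apply: HQ];
  rewrite t0.
Qed.

Lemma small_forall (T : finType) (P : T -> R -> Prop) :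
  (forall i, small (P i)) -> small (fun t => forall i, P i t).
Proof.
move=> HP; suff : small (fun t => forall i, i \in enum T -> P i t).
  by apply: small_imp => t _ H i; apply: H; rewrite mem_enum.
elim: (enum T) => [|i r IH]; first by exists 1.
apply: small_imp (small_and (HP i) IH) => t _ [Pi Pr] j.
by rewrite inE => /predU1P[->|/Pr].
Qed.

Lemma small_lt (f g : R) : 0 < f -> small (fun t => t * g < f).
Proof.
move=> f0; have g0 : 0 < `|g| + 1 by rewrite ltr_wpDl.
exists (f / (`|g| + 1)); first by rewrite divr_gt0.
move=> t /andP[t0]; rewrite ler_pdivlMr //.
have := ler_norm g; nra.
Qed.

End Small.

(** * Minimizing coordinates and complementary slackness *)

Section MinCells.
Variables (R : realFieldType) (n : nat).
Hypothesis n_gt0 : (0 < n)%N.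
Implicit Types (u v x y : 'rV[R]_n) (D : {set 'I_n}).

(** Functionals on the dual of [L] are evaluations at points [l] of [L], so the cells induced by [u]
    will be the sets [mincell (l + u)]. *)
Definition mincell u : {set 'I_n} :=
  [set e : 'I_n | [forall e' : 'I_n, u 0 e <= u 0 e']]%SET.

Lemma mincellP u e : reflect (forall e', u 0 e <= u 0 e') (e \in mincell u).
Proof. by rewrite inE; exact: forallP. Qed.

Lemma mincell_neq0 u : exists e, e \in mincell u.
Proof.
have : enum 'I_n != [::] by rewrite -size_eq0 size_enum_ord -lt0n.
move=> /(exists_argmin (fun e => u 0 e))[e _ emin]; exists e; apply/mincellP => e'.
by apply: emin; rewrite mem_enum.
Qed.

Lemma mincellD u v e : e \in mincell u -> e \in mincell v ->
  mincell (u + v) = mincell u :&: mincell v.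
Proof.
move=> /mincellP eu /mincellP ev; apply/setP => i; rewrite finset.in_setI.
apply/mincellP/andP => [H|[/mincellP Hu /mincellP Hv] j]; last first.
  by rewrite !mxE lerD.
have := H e; rewrite !mxE => He; have := eu i; have := ev i.
by split; apply/mincellP => j; [have := eu j|have := ev j]; lra.
Qed.

Lemma mincellZ k u : 0 < k -> mincell (k *: u) = mincell u.
Proof.
move=> k0; apply/setP => e; rewrite !inE.
by apply: eq_forallb => e'; rewrite !mxE ler_pM2l.
Qed.

Lemma sub_mincellD D u v :
  D \subset mincell u -> D \subset mincell v -> D \subset mincell (u + v).
Proof.
move=> Du Dv; apply/fintype.subsetP => e eD.
rewrite (mincellD (fintype.subsetP Du _ eD) (fintype.subsetP Dv _ eD)) finset.in_setI.
by rewrite (fintype.subsetP Du) // (fintype.subsetP Dv).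
Qed.

(** A small multiple of [v] cannot close a strict gap in [u]; it only breaks ties among the
    minimizers of [u]. *)
Lemma mincell_lex u v : small (fun t => forall e, e \in mincell (u + t *: v) <->
  e \in mincell u /\ forall e', e' \in mincell u -> v 0 e <= v 0 e').
Proof.
have : small (fun t => forall e e', u 0 e < u 0 e' ->
    t * (v 0 e - v 0 e') < u 0 e' - u 0 e).
  apply: small_forall => e; apply: small_forall => e'.
  have [ee'|ee'] := ltP (u 0 e) (u 0 e'); last by exists 1.
  have d0 : 0 < u 0 e' - u 0 e by rewrite subr_gt0.
  by apply: small_imp (small_lt (v 0 e - v 0 e') d0) => t _.
apply: small_imp => t t0 H e; split.
  move/mincellP => emin; have [e0 /mincellP e0u] := mincell_neq0 u.
  have eu : e \in mincell u.
    apply/mincellP => e'; rewrite leNgt; apply/negP => ee'.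
    have e0e : u 0 e0 < u 0 e by exact: le_lt_trans (e0u e') ee'.
    by have := emin e0; have := H _ _ e0e; rewrite !mxE; lra.
  split=> // e' /mincellP/(_ e) ue'; have := emin e'; rewrite !mxE => uv.
  by move/mincellP: eu => /(_ e') ue; rewrite -(ler_pM2l t0); lra.
move=> [eu ev]; apply/mincellP => e'; rewrite !mxE.
have [e'u|e'u] := boolP (e' \in mincell u).
  have := ler_pM2l t0 (v 0 e) (v 0 e'); rewrite ev // => tv.
  by move/mincellP: eu => /(_ e'); lra.
have ee' : u 0 e < u 0 e'.
  rewrite ltNge; apply: contra e'u => e'e; apply/mincellP => i.
  by apply: le_trans e'e _; exact/mincellP.
by have := H _ _ ee'; lra.
Qed.

(** [v] is constant on [mincell u], so it breaks no ties there. *)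
Lemma mincell_perturb u v : mincell u \subset mincell v ->
  small (fun t => mincell (u - t *: v) = mincell u).
Proof.
move=> uv; apply: small_imp (mincell_lex u (- v)) => t t0 H; apply/setP => e.
rewrite -scalerN; apply/idP/idP => [/H[]//|eu]; apply/H; split=> // e' e'u.
by rewrite !mxE lerN2; apply/mincellP; exact: (fintype.subsetP uv).
Qed.

(** Weak duality and complementary slackness: since the total masses agree, [dot f u] exceeds
    [dot g u] by the sum of the nonnegative terms [F e]. *)
Lemma dot_mincell (f g : 'rV[R]_n) u : (forall e, 0 <= f 0 e) ->
  (forall e, g 0 e != 0 -> e \in mincell u) ->
  dot f (const_mx 1) = dot g (const_mx 1) ->
  dot g u <= dot f u /\
  (dot f u <= dot g u -> forall e, f 0 e != 0 -> e \in mincell u).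
Proof.
move=> f0 gu fg; have [e0 /mincellP e0u] := mincell_neq0 u.
pose F e := f 0 e * (u 0 e - u 0 e0).
have F0 e : 0 <= F e by rewrite mulr_ge0 // subr_ge0.
have gE : dot g u = u 0 e0 * dot g (const_mx 1).
  rewrite mulr_sumr; apply: eq_bigr => e _; rewrite mxE mulr1 mulrC.
  have [->|/gu/mincellP/(_ e0) eu] := eqVneq (g 0 e) 0; first by rewrite !mulr0.
  by congr (_ * _); apply/le_anti; rewrite e0u eu.
have fE : dot f u = dot g u + \sum_e F e.
  rewrite gE -fg mulr_sumr -big_split /=; apply: eq_bigr => e _.
  by rewrite /F mxE; ring.
rewrite fE; split; first by rewrite lerDl sumr_ge0.
rewrite gerDl => S0 e fe.
have /psumr_eq0P : \sum_e F e = 0 by apply/le_anti; rewrite S0 sumr_ge0.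
move=> /(_ (fun e _ => F0 e))/(_ e isT)/eqP.
rewrite mulf_eq0 (negPf fe) subr_eq0 => /eqP eu.
by apply/mincellP => e'; rewrite eu.
Qed.

End MinCells.

(** * Regular subdivisions and coarsening *)

Section Complex.
Variables (R : realFieldType) (n : nat) (L : {vspace 'rV[R]_n}).
Hypothesis n_gt0 : (0 < n)%N.
Hypothesis L1 : const_mx 1 \in L.
Implicit Types (u v x y l f g : 'rV[R]_n) (D : {set 'I_n}).

(** Storing all subsets of cells turns refinement into inclusion of finite sets and provides a
    cardinality to minimize. *)
Definition subd_faces u : {set {set 'I_n}} :=
  [set D : {set 'I_n} | `[< exists2 l, l \in L & D \subset mincell (l + u) >]]%SET.

Lemma subd_facesP u D : reflect (exists2 l, l \in L & D \subset mincell (l + u))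
  (D \in subd_faces u).
Proof. by rewrite inE; exact: asboolP. Qed.

Lemma mem_subd_faces u l : l \in L -> mincell (l + u) \in subd_faces u.
Proof. by move=> lL; apply/subd_facesP; exists l. Qed.

Definition cells u : set {set 'I_n} := [set mincell (l + u) | l in [set l | l \in L]].

Definition coarser u : set 'rV[R]_n := [set v | subd_faces u \subset subd_faces v].

Lemma coarser_refl u : coarser u u.
Proof. exact: subxx. Qed.

Lemma coarser0 u : coarser u 0.
Proof.
apply/fintype.subsetP => D _; apply/subd_facesP; exists 0; rewrite ?mem0v //.
by apply/fintype.subsetP => e _; apply/mincellP => e'; rewrite !mxE.
Qed.

Lemma coarserD u v w : coarser u v -> coarser u w -> coarser u (v + w).
Proof.
move=> uv uw; apply/fintype.subsetP => D Du.
have /subd_facesP[l lL Dl] := fintype.subsetP uv _ Du.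
have /subd_facesP[l' l'L Dl'] := fintype.subsetP uw _ Du.
apply/subd_facesP; exists (l + l'); first by rewrite memvD.
by rewrite addrACA sub_mincellD.
Qed.

Lemma coarserZ u k v : 0 <= k -> coarser u v -> coarser u (k *: v).
Proof.
rewrite le_eqVlt => /predU1P[<- _|k0 uv]; first by rewrite scale0r; exact: coarser0.
apply: fintype.subset_trans uv _; apply/fintype.subsetP => D /subd_facesP[l lL Dl].
by apply/subd_facesP; exists (k *: l); rewrite ?memvZ // -scalerDr mincellZ.
Qed.

(** In other words, [u] lies in the relative interior of the cone [coarser u]. Each of the finitely
    many faces needs only a small enough [t]. *)
Lemma coarser_perturb u v : coarser u v -> small (fun t => coarser u (u - t *: v)).
Proof.
move=> uv; suff : small (fun t => forall D, D \in subd_faces u ->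
    D \in subd_faces (u - t *: v)).
  by apply: small_imp => t _ H; apply/fintype.subsetP.
apply: small_forall => D; have [|_] := boolP (D \in subd_faces u); last by exists 1.
move=> /subd_facesP[l lL Dl].
have /subd_facesP[l' l'L lv] := fintype.subsetP uv _ (mem_subd_faces u lL).
apply: small_imp (mincell_perturb n_gt0 lv) => t _ H _.
apply/subd_facesP; exists (l - t *: l'); first by rewrite memvB ?memvZ.
suff -> : l - t *: l' + (u - t *: v) = l + u - t *: (l' + v) by rewrite H.
by rewrite scalerDr opprD addrACA.
Qed.

Definition eqdeg f g := forall l, l \in L -> dot f l = dot g l.

(** The pairs [f], [l] and [g], [l'] satisfy complementary slackness, hence are optimal; slackness
    then also holds for [f], [l']. *)
Lemma eqdeg_mincell f g u l l' : l \in L -> l' \in L ->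
  (forall e, 0 <= f 0 e) -> (forall e, 0 <= g 0 e) -> eqdeg f g ->
  (forall e, f 0 e != 0 -> e \in mincell (l + u)) ->
  (forall e, g 0 e != 0 -> e \in mincell (l' + u)) ->
  forall e, f 0 e != 0 -> e \in mincell (l' + u).
Proof.
move=> lL l'L f0 g0 fg fl gl'.
have [+ _] := dot_mincell n_gt0 g0 fl (esym (fg _ L1)).
rewrite !dotDr -fg // lerD2l => fgu.
have [_] := dot_mincell n_gt0 f0 gl' (fg _ L1); apply.
by rewrite !dotDr fg // lerD2l.
Qed.

(* Linear programming duality: g and l are optimal for minimizing [dot g u]
   over the nonnegative g of the same degree as f, and for its dual problem. *)
Lemma subd_complete f u : (forall e, 0 <= f 0 e) -> 0 < dot f (const_mx 1) ->
  exists l g, [/\ l \in L, forall e, 0 <= g 0 e, eqdeg f g &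
    forall e, g 0 e != 0 -> e \in mincell (l + u)].
Proof.
move=> f0 f1; set one := const_mx 1 in f1.
pose s0 : seq 'rV[R]_n := [seq delta_mx 0 i | i <- enum 'I_n].
have s0P x : feasible s0 x <-> forall i, 0 <= x 0 i.
  split=> H i; first by rewrite -dot_delta; apply/H/map_f; rewrite mem_enum.
  by case/mapP => j _ ->; rewrite dot_delta.
(* Every element of [L] is a multiple of [one] plus an element of [L] killed by [f]. After
   eliminating the latter, the dual problem asks for the largest [t] such that [u - t *: one] is
   feasible for [s]. *)
have [s [sQ sW sP]] := eliminate_subspace s0 (L :&: lker (dot_lfun f))%VS.
have s_ge0 h : h \in s -> forall i, 0 <= h 0 i.
  apply: (sQ (fun h => forall i, 0 <= h 0 i)).
    by move=> a b x y a0 b0 x0 y0 i; rewrite !mxE addr_ge0 ?mulr_ge0.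
  by move=> _ /mapP[j _ ->] i; rewrite mxE; exact: ler0n.
have s_eq0 h x : h \in s -> ~~ (0 < dot h one) -> dot h x = 0.
  move=> hs; have hi i : 0 <= h 0 i by exact: s_ge0.
  have -> : dot h one = \sum_i h 0 i by apply: eq_bigr => i _; rewrite mxE mulr1.
  rewrite lt_neqAle sumr_ge0 // andbT negbK eq_sym => /eqP/psumr_eq0P H.
  by rewrite /dot big1 // => i _; rewrite H ?mul0r.
have Wf y : y \in (L :&: lker (dot_lfun f))%VS -> y \in L /\ dot f y = 0.
  by rewrite memv_cap memv_ker dot_lfunE => /andP[? /eqP].
pose s1 := [seq h <- s | 0 < dot h one].
have s1_neq0 : s1 != [::].
  (* Otherwise every [t] would be feasible; this one gives [f] the value -1 on a nonnegative
     vector. *)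
  apply/negP => /eqP s10; pose t := (dot f u + 1) / dot f one.
  have /sP[y /Wf[_ fy] /s0P H] : feasible s (u - t *: one).
    move=> h hs; rewrite s_eq0 //; apply/negP => h1.
    by have : h \in s1 by [rewrite mem_filter h1]; rewrite s10.
  have : 0 <= dot f (u - t *: one + y) by apply: sumr_ge0 => i _; rewrite mulr_ge0.
  by rewrite !dotDr dotNr dotZr fy /t mulfVK ?gt_eqF //; lra.
have [h] := exists_argmin (fun h => dot h u / dot h one) s1_neq0.
rewrite mem_filter => /andP[h1 hs] hmin; set t := dot h u / dot h one in hmin.
have /sP[y /[dup] yW /Wf[yL fy] /s0P H] : feasible s (u - t *: one).
  move=> k ks; have [k1|/s_eq0-> //] := boolP (0 < dot k one).
  rewrite dotDr dotNr dotZr subr_ge0 -ler_pdivlMr //.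
  by apply: hmin; rewrite mem_filter k1.
have h0 i : 0 <= h 0 i by exact: s_ge0.
have hy : dot h (u - t *: one + y) = 0.
  by rewrite !dotDr dotNr dotZr (sW _ hs y yW) /t mulfVK ?gt_eqF //; ring.
(* The tight inequality [h] vanishes on the elements of [L] killed by [f], so it is proportional to
   [f] on [L]; the factor matches their values at [one]. *)
exists y, ((dot f one / dot h one) *: h); split=> //.
- by move=> e; rewrite mxE mulr_ge0 // divr_ge0 // ltW.
- move=> l lL; rewrite dotZl.
  have : dot h (l - (dot f l / dot f one) *: one) = 0.
    apply: sW hs _ _; rewrite memv_cap memvB ?memvZ //= memv_ker dot_lfunE.
    by rewrite dotDr dotNr dotZr mulfVK ?subrr // gt_eqF.
  rewrite dotDr dotNr dotZr => /eqP; rewrite subr_eq0 => /eqP ->.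
  by field; rewrite !gt_eqF.
move=> e; rewrite mxE mulf_eq0 negb_or => /andP[_ he].
have /psumr_eq0P HS : \sum_i h 0 i * (u - t *: one + y) 0 i = 0 by exact: hy.
have /eqP : h 0 e * (u - t *: one + y) 0 e = 0.
  by apply: HS => // i _; rewrite mulr_ge0.
rewrite mulf_eq0 (negPf he) !mxE => /eqP ue.
by apply/mincellP => e'; have := H e'; rewrite !mxE; lra.
Qed.

(** For a nonempty face [D], duality yields [g] of the same degree as the indicator of [D],
    supported on a cell of [u]. That cell lies in a cell of [v] and in one of [w], whose
    intersection is a cell of [v + w]; by [eqdeg_mincell] it contains [D]. *)
Lemma subd_faces_coarserD u v w : coarser u v -> coarser u w ->
  subd_faces (v + w) \subset subd_faces v.
Proof.
move=> uv uw; apply/fintype.subsetP => D /subd_facesP[l lL Dl].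
have [->|[e0 e0D]] := finset.set_0Vmem D.
  by apply/subd_facesP; exists 0; rewrite ?mem0v // finset.sub0set.
pose f : 'rV[R]_n := \row_e (e \in D)%:R.
have f0 e : 0 <= f 0 e by rewrite mxE ler0n.
have f1 : 0 < dot f (const_mx 1).
  rewrite /dot (bigD1 e0) //= !mxE e0D mulr1 ltr_pwDl //.
  by apply: sumr_ge0 => i _; rewrite !mxE mulr1 ler0n.
have [l0 [g [l0L g0 fg gl0]]] := subd_complete u f0 f1.
have l0u := mem_subd_faces u l0L.
have /subd_facesP[l1 l1L l01] := fintype.subsetP uv _ l0u.
have /subd_facesP[l2 l2L l02] := fintype.subsetP uw _ l0u.
have [e1 e1P] := mincell_neq0 n_gt0 (l0 + u).
have E : mincell ((l1 + l2) + (v + w)) = mincell (l1 + v) :&: mincell (l2 + w).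
  rewrite addrACA.
  exact: mincellD (fintype.subsetP l01 _ e1P) (fintype.subsetP l02 _ e1P).
apply/subd_facesP; exists l1 => //; apply/fintype.subsetP => e eD.
suff : e \in mincell ((l1 + l2) + (v + w)) by rewrite E finset.in_setI => /andP[].
apply: (eqdeg_mincell lL _ f0 g0 fg).
- by rewrite memvD.
- by move=> i; rewrite mxE pnatr_eq0 eqb0 negbK => /(fintype.subsetP Dl).
- move=> i /gl0 il0; rewrite E finset.in_setI (fintype.subsetP l01) //.
  exact: (fintype.subsetP l02).
by rewrite mxE eD oner_eq0.
Qed.

(** As [t] tends to 0 this exhibits [v] as a limit of weights inducing the subdivision of [u]. *)
Lemma cells_perturb u v t : 0 < t -> coarser u v -> cells (v + t *: u) = cells u.
Proof.
move=> t0 uv; set w := v + t *: u.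
have cellE l : l \in L -> exists2 l', l' \in L &
    mincell (l' + w) = mincell (l + u).
  move=> lL.
  have /subd_facesP[l' l'L sub] := fintype.subsetP uv _ (mem_subd_faces u lL).
  have [e el] := mincell_neq0 n_gt0 (l + u).
  exists (l' + t *: l); first by rewrite memvD ?memvZ.
  rewrite addrACA -scalerDr (mincellD (fintype.subsetP sub _ el)) mincellZ //.
  exact/finset.setIidPr.
apply/seteqP; split=> _ [l1 /= l1L <-]; last first.
  by have [l' l'L <-] := cellE _ l1L; exists l'.
have : mincell (l1 + w) \in subd_faces u.
  have tu : coarser u (t *: u) by apply: coarserZ (coarser_refl u); exact: ltW.
  have := fintype.subsetP (subd_faces_coarserD tu uv) _ (mem_subd_faces _ l1L).
  rewrite [t *: u + v]addrC; apply/fintype.subsetP.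
  have t1 : 0 <= t^-1 by rewrite invr_ge0 ltW.
  have := coarserZ t1 (coarser_refl (t *: u)).
  by rewrite scalerA mulVf ?scale1r ?gt_eqF.
case/subd_facesP => l0 l0L D10; have [l l_L wl] := cellE _ l0L.
(* On the cell of [l0 + u] the vector [l + w] is constant, so breaking ties there by [l1 - l]
   amounts to minimizing [l1 + w]. *)
have [t' t'0 H] := small_ex (mincell_lex n_gt0 (l0 + u) (l1 - l)).
exists (l0 + t' *: (l1 - l)); first by rewrite /= memvD ?memvZ ?memvB.
apply/setP => e; rewrite addrAC; apply/idP/idP => [/H[el0 emin]|el1].
  have [e1 e1P] := mincell_neq0 n_gt0 (l1 + w).
  have := emin _ (fintype.subsetP D10 _ e1P).
  move: el0 (fintype.subsetP D10 _ e1P); rewrite -wl.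
  move=> /mincellP/(_ e1) + /mincellP/(_ e).
  move/mincellP: e1P => e1P; rewrite !mxE => ee1 e1e le1.
  by apply/mincellP => e'; have := e1P e'; rewrite !mxE; lra.
apply/H; split; first exact: (fintype.subsetP D10).
move=> e' e'D; move: (fintype.subsetP D10 _ el1) e'D; rewrite -wl.
move=> /mincellP/(_ e') + /mincellP/(_ e).
by move/mincellP: el1 => /(_ e'); rewrite !mxE; lra.
Qed.

(** The inclusion [D \subset mincell x] is a finite system of inequalities in [x]; eliminating [L]
    leaves one in [u]. *)
Lemma subd_faces_polyhedral D :
  exists s, forall u, D \in subd_faces u <-> feasible s u.
Proof.
pose d i : 'rV[R]_n := delta_mx 0 i.
have dotB e e' x : dot (d e' - d e) x = x 0 e' - x 0 e.
  by rewrite dotC dotDr dotNr !(dotC x) !dot_delta.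
pose s0 := [seq d e' - d e | e <- enum D, e' <- enum 'I_n].
have s0P x : feasible s0 x <-> D \subset mincell x.
  split=> [H|/fintype.subsetP H _ /allpairsP[[e e'] /= [+ _ ->]]].
    apply/fintype.subsetP => e eD; apply/mincellP => e'.
    rewrite -subr_ge0 -dotB.
    by apply: H; apply: allpairs_f; rewrite mem_enum.
  rewrite mem_enum => /H/mincellP/(_ e').
  by rewrite dotB subr_ge0.
have [s [_ _ sP]] := eliminate_subspace s0 L.
exists s => u; rewrite -sP; split.
  by case/subd_facesP => l lL Dl; exists l => //; apply/s0P; rewrite addrC.
by case=> l lL /s0P Dl; apply/subd_facesP; exists l; rewrite // addrC.
Qed.

Lemma coarser_polyhedral u : exists s, coarser u = feasible s.
Proof.
have [s sP] : exists s, forall v,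
    (forall D, D \in enum (subd_faces u) -> D \in subd_faces v) <-> feasible s v.
  elim: (enum _) => [|D r [s sP]]; first by exists [::].
  have [s' s'P] := subd_faces_polyhedral D.
  exists (s' ++ s) => v; split=> [H f|H E].
    rewrite mem_cat => /orP[]; first exact: ((s'P v).1 (H D (mem_head _ _))).
    by move: f; apply/sP => D' D'r; apply: H; rewrite inE D'r orbT.
  rewrite inE => /predU1P[->|Er].
    by apply/s'P => f fs'; apply: H; rewrite mem_cat fs'.
  by apply: (sP v).2 Er => f fs; apply: H; rewrite mem_cat fs orbT.
exists s; apply/funext => v; apply/propext; rewrite -sP; split.
  by move=> /fintype.subsetP H D; rewrite mem_enum => /H.
by move=> H; apply/fintype.subsetP => D Du; apply: H; rewrite mem_enum.
Qed.

End Complex.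

(** * Secondary cones, their faces and intersections *)

Section SecondaryFan.
Variables (R : realType) (n : nat) (L : {vspace 'rV[R]_n}).
Hypothesis n_gt0 : (0 < n)%N.
Hypothesis L1 : const_mx 1 \in L.
Implicit Types (u v p : 'rV[R]_n) (F O : set 'rV[R]_n).

Lemma cells_coarser u v : cells L v = cells L u -> coarser L u v.
Proof.
move=> vu; apply/fintype.subsetP => D /subd_facesP[l lL Dl].
have : cells L v (mincell (l + u)) by rewrite vu; exists l.
by case=> l' l'L E; apply/subd_facesP; exists l'; rewrite ?E.
Qed.

(** The points [p + t *: u] approach any coarser [p]; conversely, finitely many weak inequalities
    define a closed set. *)
Lemma closure_cells u :
  closure [set v | cells L v = cells L u] = coarser L u.
Proof.
apply/seteqP; split=> p; last first.
  move=> up B /nbhs_ballP[e /= e0 eB].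
  have [t t0 tu] : exists2 t, 0 < t & forall i, t * `|u 0 i| < e.
    by apply: small_ex; apply: small_forall => i; exact: small_lt.
  exists (p + t *: u); split; first exact: cells_perturb.
  apply: eB; split=> // i j; rewrite ord1 /ball /= !mxE opprD addNKr normrN.
  by rewrite normrM (gtr0_norm t0).
have [s sE] := coarser_polyhedral L u; rewrite sE => clp f fs.
rewrite leNgt; apply/negP; rewrite -oppr_gt0 => fp.
have [t t0 tf] := small_ex (small_lt (\sum_i `|f 0 i|) fp).
have [v [vu vp]] := clp _ (nbhsx_ballx p t t0).
have : feasible s v by rewrite -sE; exact: cells_coarser.
move=> /(_ _ fs); rewrite leNgt => /negP; apply.
rewrite -(subrK p v) dotDr -ltrBrDr sub0r; apply: le_lt_trans tf.
rewrite mulr_sumr; apply: ler_sum => i _.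
apply: le_trans (ler_norm _) _; rewrite normrM mulrC ler_wpM2r //.
have [_ /(_ 0 i)] := vp; rewrite /ball /= !mxE distrC; exact: ltW.
Qed.

(** Take [v] in [F] with the fewest faces. The faces of [v + w] are among those of [v] and of [w],
    and by minimality they are all those of [v]. *)
Lemma finest_point u F : F !=set0 -> F `<=` coarser L u ->
  (forall x y, F x -> F y -> F (x + y)) ->
  exists2 v, F v & F `<=` coarser L v.
Proof.
move=> [x Fx] Fu FD.
have : exists k, `[< exists2 v, F v & #|subd_faces L v| = k >].
  by exists #|subd_faces L x|; apply/asboolP; exists x.
case/ex_minnP => _ /asboolP[v Fv <-] vmin; exists v => // w Fw.
have sub := subd_faces_coarserD n_gt0 L1 (Fu _ Fv) (Fu _ Fw).
have /eqP E : subd_faces L (v + w) == subd_faces L v.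
  rewrite eqEcard sub vmin //; apply/asboolP.
  by exists (v + w) => //; exact: FD.
rewrite -[coarser _ _ _]/(is_true (_ \subset _)) -E [v + w]addrC.
exact: (subd_faces_coarserD n_gt0 L1 (Fu _ Fw) (Fu _ Fv)).
Qed.

Lemma coarser_trans u v : coarser L u v -> coarser L v `<=` coarser L u.
Proof. by move=> uv w; exact: fintype.subset_trans. Qed.

(** [v] is a finest point of the face. For [w] coarser than [v], some [v - t *: w] stays in the
    cone, and [phi v = 0] then forces [phi w <= 0]. *)
Lemma face_coarserP F u : is_face F (coarser L u) ->
  exists2 v, coarser L u v & F = coarser L v.
Proof.
case=> phi [phi0 ->]; set G := _ `&` _.
have [||x y [ux /= x0] [uy /= y0]|v [uv /= v0] Gv] := @finest_point u G.
- by exists 0; split; [exact: coarser0 | rewrite /= linear0].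
- by move=> x [].
- by split; [exact: coarserD | rewrite /= linearD /= x0 y0 addr0].
exists v => //; apply/seteqP; split=> // w vw.
have uw := coarser_trans uv vw; split=> //=.
have [t t0 /(coarser_trans uv)/phi0] := small_ex (coarser_perturb n_gt0 vw).
rewrite linearB linearZ /= v0 sub0r oppr_ge0 => phiw.
by apply/le_anti; rewrite phi0 // andbT -(pmulr_rle0 _ t0).
Qed.

Lemma coarser_face u v : coarser L u v -> is_face (coarser L v) (coarser L u).
Proof.
move=> uv; have [s sE] := coarser_polyhedral L u.
have sv : feasible s v by rewrite -sE.
(* The face is cut out by the sum of the inequalities tight at [v]. *)
pose f := \sum_(g <- s | dot g v == 0) g.
have fE x : dot f x = \sum_(g <- s | dot g v == 0) dot g x by exact: dot_suml.
exists (dot_lfun f); split.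
  move=> x; rewrite sE => sx; rewrite dot_lfunE fE big_seq_cond.
  by apply: sumr_ge0 => g /andP[/sx].
have fv : dot f v = 0 by rewrite fE big1 // => g /eqP.
apply/seteqP; split=> w.
  move=> vw; have uw := coarser_trans uv vw; split=> //=.
  have [t t0 /(coarser_trans uv)] := small_ex (coarser_perturb n_gt0 vw).
  rewrite sE => Hs; have f_ge0 x : feasible s x -> 0 <= dot f x.
    by move=> sx; rewrite fE big_seq_cond sumr_ge0 // => g /andP[/sx].
  have := f_ge0 _ Hs; rewrite dot_lfunE dotDr dotNr dotZr fv sub0r oppr_ge0.
  rewrite pmulr_rle0 // => fw; apply/le_anti; rewrite fw f_ge0 //.
  by rewrite -sE.
case=> uw /=; rewrite dot_lfunE => fw.
have sw : feasible s w by rewrite -sE.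
have g0 g : g \in s -> dot g v = 0 -> dot g w = 0.
  move=> gs gv; move: fw; rewrite fE big_seq_cond => /eqP.
  rewrite psumr_eq0; last by move=> h /andP[/sw].
  by move=> /allP/(_ g gs); rewrite gs gv eqxx /= => /eqP.
(* All inequalities tight at [v] are tight at [w], so [v] is a sum of [t *: w] and a point of the
   cone, hence refines [w]. *)
have [t t0 H] : exists2 t, 0 < t & forall g : seq_sub s, 0 <= dot (val g) (v - t *: w).
  apply: small_ex; apply: small_forall => -[g gs] /=.
  have [gv|gv] := eqVneq (dot g v) 0.
    by exists 1 => // t _; rewrite dotDr dotNr dotZr gv g0 // mulr0 subr0.
  have gv0 : 0 < dot g v by rewrite lt0r gv sv.
  apply: small_imp (small_lt (dot g w) gv0) => t _.
  by rewrite dotDr dotNr dotZr subr_ge0; exact: ltW.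
have uvw : coarser L u (v - t *: w).
  by rewrite sE => g gs; exact: (H (SeqSub gs)).
have := subd_faces_coarserD n_gt0 L1 (coarserZ (ltW t0) uw) uvw.
rewrite subrKC => /fintype.subset_trans; apply.
have t1 : 0 <= t^-1 by rewrite invr_ge0 ltW.
have := coarserZ t1 (coarser_refl L (t *: w)).
by rewrite scalerA mulVf ?scale1r ?gt_eqF.
Qed.

Lemma coarserI u v : exists w, [/\ coarser L u w, coarser L v w &
  coarser L u `&` coarser L v = coarser L w].
Proof.
have [||x y [ux vx] [uy vy]|w [uw vw] Fw] :=
  @finest_point u (coarser L u `&` coarser L v).
- by exists 0; split; exact: coarser0.
- by move=> x [].
- by split; exact: coarserD.
exists w; split=> //; apply/seteqP; split=> // x wx.
by split; [exact: coarser_trans uw _ wx | exact: coarser_trans vw _ wx].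
Qed.

Lemma coarser_fan O : (forall u, O u -> coarser L u `<=` O) ->
  is_fan [set coarser L u | u in O].
Proof.
move=> OC; split.
(* A cone depends only on the finite set of faces of [u]. *)
- pose G (A : {set {set 'I_n}}) : set 'rV[R]_n := [set v | A \subset subd_faces L v].
  apply: (@sub_finite_set _ _ (G @` setT)) => [_ [u _ <-]|].
    by exists (subd_faces L u).
  by apply: finite_image; exact: finite_finset.
- move=> _ [u _ <-]; have [s ->] := coarser_polyhedral L u.
  exists (map (@dot_lfun R n) s); apply/seteqP; split=> x H.
    by move=> _ /mapP[f fs ->]; rewrite dot_lfunE; exact: H.
  by move=> f fs; rewrite -dot_lfunE; apply/H/map_f.
- move=> _ F [u Ou <-] /face_coarserP[v uv ->]; exists v => //.
  exact: (OC u).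
move=> _ _ [u _ <-] [v _ <-]; have [w [uw vw ->]] := coarserI u v.
by split; exact: coarser_face.
Qed.

End SecondaryFan.

(** * Reflection of fans in the origin *)

Section OppositeFan.
Variables (R : realType) (V : vectType R).
Implicit Types (C F : set V) (Phi : set (set V)).

Lemma oppimageE C : -%R @` C = [set x | C (- x)].
Proof.
apply/seteqP; split=> [_ [x Cx <-] /=|x /= Cx]; first by rewrite opprK.
by exists (- x); rewrite ?opprK.
Qed.

Lemma oppimageK C : -%R @` (-%R @` C) = C.
Proof. by rewrite !oppimageE; apply/funext => x /=; rewrite opprK. Qed.

Lemma face_opp F C : is_face F C -> is_face (-%R @` F) (-%R @` C).
Proof.
case=> phi [phi0 ->]; exists (- phi); rewrite !oppimageE; split=> [x /=|].
  by move=> /phi0; rewrite opp_lfunE linearN.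
apply/funext => x /=; apply/propext.
by rewrite opp_lfunE linearN.
Qed.

Lemma polyhedral_opp C : polyhedral_cone C -> polyhedral_cone (-%R @` C).
Proof.
case=> s ->; exists (map -%R s); rewrite oppimageE.
apply/seteqP; split=> x /= H phi.
  by move=> /mapP[psi /H + ->]; rewrite opp_lfunE linearN.
by move=> ps; have := H _ (map_f _ ps); rewrite opp_lfunE linearN.
Qed.

Lemma fan_opp Phi : is_fan Phi -> is_fan (opp_fan Phi).
Proof.
case=> finP polyP faceP intP; split.
- exact: finite_image.
- by move=> _ [C PC <-]; exact/polyhedral_opp/polyP.
- move=> _ F [C PC <-] /face_opp; rewrite oppimageK => /(faceP _ _ PC) PF.
  by exists (-%R @` F); rewrite ?oppimageK.
move=> _ _ [C PC <-] [C' PC' <-]; have [fC fC'] := intP _ _ PC PC'.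
have <- : -%R @` (C `&` C') = (-%R @` C) `&` (-%R @` C') by rewrite !oppimageE.
by split; exact: face_opp.
Qed.

End OppositeFan.

(** * Subdivisions of the configuration of [I] *)

Section LinealityConfiguration.
Variables (R : realType) (n : nat) (I : set {mpoly R[i][n]}).
Implicit Types u : 'rV[R]_n.
Let L := lineality_vspace I.
Let U : vectType R := subvs_of L.

(** Finite-dimensional biduality: the coordinates of [l] are the values of [f] on the dual basis. *)
Lemma lfun_dual_eval (f : 'Hom('Hom(U, R^o), R^o)) :
  exists l : U, forall a : 'Hom(U, R^o), f a = a l.
Proof.
pose b := vbasis {: U}.
pose c i : 'Hom(U, R^o) := linfun (coord b i : U -> R^o).
exists (\sum_(i < \dim {: U}) (f (c i) : R) *: b`_i) => a.
have aE : a = \sum_(i < \dim {: U}) (a b`_i : R) *: c i.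
  apply/lfunP => x; rewrite sum_lfunE {1}(coord_vbasis (memvf x)) linear_sum.
  apply: eq_bigr => i _; rewrite linearZ scale_lfunE lfunE /=.
  exact: mulrC.
rewrite {1}aE !linear_sum; apply: eq_bigr => i _; rewrite !linearZ.
exact: mulrC.
Qed.

Lemma dual_evalE (l : U) : exists f : 'Hom('Hom(U, R^o), R^o),
  forall a : 'Hom(U, R^o), f a = a l.
Proof.
pose g (a : 'Hom(U, R^o)) : R^o := a l.
have g_lin : linear g by move=> k x y; rewrite /g add_lfunE scale_lfunE.
pose gL := GRing.isLinear.Build _ _ _ _ g g_lin.
pose gl : {linear _ -> _} := HB.pack g gL.
by exists (linfun gl) => a; rewrite lfunE.
Qed.

Lemma subd_lineality_config u : subd (lineality_config I) u = cells L u.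
Proof.
have cellE (f : 'Hom('Hom(U, R^o), R^o)) (l : U) :
    (forall a : 'Hom(U, R^o), f a = a l) ->
    cell (lineality_config I) u f = mincell (vsval l + u).
  move=> fl; apply/setP => e; rewrite !inE; apply: eq_forallb => e'.
  by rewrite !fl !lineality_configE !mxE.
apply/seteqP; split=> [_ [f _ <-]|_ [l /= lL <-]].
  have [l fl] := lfun_dual_eval f.
  by rewrite (cellE _ _ fl); exists (vsval l) => //; exact: subvsP.
have [f fl] := dual_evalE (vsproj L l).
by exists f => //; rewrite (cellE _ _ fl) vsprojK.
Qed.

End LinealityConfiguration.

(** * Supports of monomials *)

Section MonomialSupports.
Variables (K : comNzRingType) (n : nat).
Implicit Types (m : 'X_{1..n}) (D : {set 'I_n}) (p q a : {mpoly K[n]}).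
Implicit Types P : 'X_{1..n} -> Prop.

Definition msupport m : {set 'I_n} := [set e | m e != 0%N]%SET.

Lemma msupportD m m' : msupport (m + m') = (msupport m :|: msupport m')%SET.
Proof. by apply/setP => e; rewrite !inE mnmDE addn_eq0 negb_and. Qed.

Definition monomials_in P p := forall m, m \in msupp p -> P m.

Lemma monomials_in0 P : monomials_in P 0.
Proof. by move=> m; rewrite msupp0. Qed.

Lemma monomials_inD P p q :
  monomials_in P p -> monomials_in P q -> monomials_in P (p + q).
Proof. by move=> Pp Pq m /msuppD_le; rewrite mem_cat => /orP[/Pp|/Pq]. Qed.

Lemma monomials_inZ P k p : monomials_in P p -> monomials_in P (k *: p).
Proof. by move=> Pp m /msuppZ_le/Pp. Qed.

Lemma off_mull D a p : monomials_in (fun m => ~~ (msupport m \subset D)) p ->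
  monomials_in (fun m => ~~ (msupport m \subset D)) (a * p).
Proof.
move=> Dp _ /msuppM_le/allpairsP[[m1 m2] /= [_ /Dp m2D ->]].
by apply: contra m2D; rewrite msupportD finset.subUset => /andP[].
Qed.

End MonomialSupports.

(** * Initial ideals, cell ideals and the grading by the dual of [L] *)

Section InitialDegenerations.
Variables (R : realType) (n : nat) (I : set {mpoly R[i][n]}).
Hypothesis Iid : is_ideal I.
Local Notation S := {mpoly R[i][n]}.
Implicit Types (w u : 'rV[R]_n) (m : 'X_{1..n}) (D : {set 'I_n}) (p q : S).
Let L := lineality_vspace I.

Lemma mpoly_off_ideal (J : set S) D p : is_ideal J ->
  (forall e, e \notin D -> J 'X_e) ->
  monomials_in (fun m => ~~ (msupport m \subset D)) p -> J p.
Proof.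
move=> Jid JX Dp; rewrite [p]mpolyE; apply: ideal_sum => // m /Dp.
case: Jid => _ _ JM /fintype.subsetPn[e]; rewrite inE => me eD.
have -> : 'X_[m] = 'X_[m - U_(e)] * 'X_e :> S.
  rewrite -mpolyXD submK //; apply/mnm_lepP => i; rewrite mnm1E.
  by case: eqP => // <-; rewrite lt0n.
by rewrite scalerAl; exact/JM/JX.
Qed.

(** [q] is [p] with the variables outside [D] set to zero. Multiplying by [a] multiplies [q] by the
    part [a1] of [a] supported on [D]. *)
Lemma cell_ideal_split D p : cell_ideal I D p -> exists q,
  [/\ I q, monomials_in (fun m => msupport m \subset D) q &
    monomials_in (fun m => ~~ (msupport m \subset D)) (p - q)].
Proof.
have [I0 ID IM] := Iid.
move: p; apply: smallest_sub.
  split.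
  - by exists 0; rewrite subr0; split=> //; exact: monomials_in0.
  - move=> p p' [q [Iq Dq Dpq]] [q' [Iq' Dq' Dpq']]; exists (q + q'); split.
    + exact: ID.
    + exact: monomials_inD.
    + by rewrite opprD addrACA; exact: monomials_inD.
  move=> a p [q [Iq Dq Dpq]].
  pose a1 : S := \sum_(m <- msupp a | msupport m \subset D) a@_m *: 'X_[m].
  have a1E m : a1@_m = if msupport m \subset D then a@_m else 0.
    exact: (mcoeff_filter (fun m => msupport m \subset D)).
  exists (a1 * q); split; first exact: IM.
    move=> _ /msuppM_le/allpairsP[[m1 m2] /= [+ /Dq m2D ->]].
    rewrite mcoeff_msupp a1E msupportD finset.subUset m2D andbT.
    by case: ifP => //; rewrite eqxx.
  have -> : a * p - a1 * q = a1 * (p - q) + p * (a - a1) by ring.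
  apply: monomials_inD; first exact: off_mull.
  apply: off_mull => m; rewrite mcoeff_msupp mcoeffB a1E.
  by case: ifP => //; rewrite subrr eqxx.
move=> p [[Ip Dp]|[e /= eD <-]].
  exists p; split=> //; last by rewrite subrr; exact: monomials_in0.
  move=> m mp; apply/fintype.subsetP => e; rewrite inE.
  by apply: contraNT => /(Dp _ mp) ->.
exists 0; split=> //; first exact: monomials_in0.
rewrite subr0 => m; rewrite msuppX inE => /eqP->.
by apply/fintype.subsetPn; exists e; rewrite // inE mnm1E eqxx.
Qed.

Definition mvec m : 'rV[R]_n := \row_e (m e)%:R.

Lemma mvecD (m m' : 'X_{1..n}) : mvec (m + m')%MM = mvec m + mvec m'.
Proof. by apply/rowP => e; rewrite !mxE mnmDE natrD. Qed.

Lemma mweight_dot w m : mweight w m = dot w (mvec m).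
Proof. by apply: eq_bigr => e _; rewrite mxE mulr_natr. Qed.

Lemma mvec_ge0 m e : 0 <= mvec m 0 e.
Proof. by rewrite mxE ler0n. Qed.

Lemma mvec_supp (m : 'X_{1..n}) D :
  (forall e, mvec m 0 e != 0 -> e \in D) <-> msupport m \subset D.
Proof.
split=> [H|/fintype.subsetP H e].
  by apply/fintype.subsetP => e; rewrite inE => me; apply: H; rewrite mxE pnatr_eq0.
by rewrite mxE pnatr_eq0 => me; apply: H; rewrite inE.
Qed.

Lemma mweight_mdeg m : mweight (const_mx 1) m = (mdeg m)%:R :> R.
Proof.
by rewrite mdegE natr_sum; apply: eq_bigr => e _; rewrite mxE.
Qed.

(* Equality of degrees in the grading of S by the dual of L, in which x_e has
   degree a_e. *)
Definition same_deg m m' := eqdeg L (mvec m) (mvec m').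

Lemma same_degE m m' l : same_deg m m' -> l \in L -> mweight l m = mweight l m'.
Proof. by move=> mm' lL; rewrite !mweight_dot dotC mm' // dotC. Qed.

Lemma same_degP m m' : reflect (same_deg m m')
  (all (fun l => mweight l m == mweight l m') (vbasis L)).
Proof.
apply: (iffP allP) => [H l lL|H l lL]; last first.
  by rewrite (same_degE H) ?eqxx // (vbasis_mem lL).
rewrite (coord_vbasis lL) dotC [in RHS]dotC !dot_suml; apply: eq_bigr => i _.
rewrite !dotZl -!mweight_dot; congr (_ * _); apply/eqP/H.
by rewrite mem_nth // size_tuple.
Qed.

Lemma same_deg_sym m m' : same_deg m m' -> same_deg m' m.
Proof. by move=> mm' l lL; rewrite mm'. Qed.

Lemma same_deg_trans m m' m2 : same_deg m m' -> same_deg m' m2 -> same_deg m m2.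
Proof. by move=> mm' m'm l lL; rewrite mm' ?m'm. Qed.

(** Taking weight components along a basis of [L] in turn lets [linealityE] keep the result in
    [I]. *)
Definition degcomp m p : S :=
  foldr (fun l q => mwcomp l (mweight l m) q) p (vbasis L).

Lemma degcompE m p m' : (degcomp m p)@_m' = if `[< same_deg m' m >] then p@_m' else 0.
Proof.
have -> : `[< same_deg m' m >] = all (fun l => mweight l m' == mweight l m) (vbasis L).
  by apply/asboolP/same_degP.
rewrite /degcomp; elim: (tval _) => //= l r IH; rewrite mwcompE IH.
by case: eqP.
Qed.

Lemma degcomp_mem m p : I p -> I (degcomp m p).
Proof.
rewrite /degcomp => Ip; have : {subset (vbasis L : seq _) <= L} by move=> l /vbasis_mem.
elim: (tval _) => //= l r IH H; apply: (linealityE _ Iid).1.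
  by apply/(mem_lineality_vspace _ Iid)/H; rewrite mem_head.
by apply: IH => x xr; apply: H; rewrite inE xr orbT.
Qed.

Lemma msupp_degcomp m p m' : m' \in msupp (degcomp m p) ->
  same_deg m' m /\ m' \in msupp p.
Proof.
rewrite !mcoeff_msupp degcompE; case: asboolP => //.
by rewrite eqxx.
Qed.

Lemma ideal_degcomps (J : set S) p : is_ideal J ->
  (forall m, m \in msupp p -> J (degcomp m p)) -> J p.
Proof.
move=> Jid; have [J0 JD _] := Jid.
have [k] := ubnP (size (msupp p)); elim: k p => // k IH p; rewrite ltnS => pk Jp.
have [->//|] := eqVneq p 0; rewrite -msupp_eq0.
case E: (msupp p) => [//|m r] _.
have mp : m \in msupp p by rewrite E mem_head.
rewrite -(subrK (degcomp m p) p); apply: JD (Jp _ mp); set q := p - _.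
have qE m' : q@_m' = if `[< same_deg m' m >] then 0 else p@_m'.
  by rewrite mcoeffB degcompE; case: ifP; rewrite ?subrr ?subr0.
have qp m' : m' \in msupp q -> m' \in msupp p /\ ~ same_deg m' m.
  by rewrite !mcoeff_msupp qE; case: asboolP; rewrite ?eqxx.
apply: IH.
  apply: leq_trans pk; rewrite (perm_size (perm_to_rem mp)) /= ltnS.
  apply: uniq_leq_size; first exact: msupp_uniq.
  move=> m' /qp[m'p nm']; rewrite mem_rem_uniq ?msupp_uniq // inE m'p andbT.
  by apply/eqP => m'm; apply: nm'; rewrite m'm.
move=> m' /qp[m'p nm']; suff -> : degcomp m' q = degcomp m' p by exact: Jp.
apply/mpolyP => m1; rewrite !degcompE qE; case: asboolP => // m1m'.
case: asboolP => // m1m; case: nm' => l lL.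
by rewrite -m1m' // m1m.
Qed.

Hypothesis n_gt0 : (0 < n)%N.
Hypothesis L1 : const_mx 1 \in L.

Lemma same_deg_mdeg m m' : same_deg m m' -> mdeg m = mdeg m'.
Proof.
by move=> mm'; apply/eqP; rewrite -(eqr_nat R) -!mweight_mdeg (same_degE mm').
Qed.

Definition face_monomial u m := msupport m \in subd_faces L u.

(** [dot_mincell] for exponent vectors: [l] contributes equally to both weights and cancels. *)
Lemma cell_weight u l m m' : l \in L -> same_deg m m' ->
  msupport m \subset mincell (l + u) ->
  mweight u m <= mweight u m' /\
  (mweight u m' <= mweight u m -> msupport m' \subset mincell (l + u)).
Proof.
move=> lL mm' ml; rewrite !mweight_dot.
have [] := dot_mincell n_gt0 (mvec_ge0 m') ((mvec_supp _ _).2 ml) (esym (mm' _ L1)).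
rewrite !dotDr mm' // !lerD2l -!(dotC u) => le1 H; split=> // wm.
by apply/mvec_supp; exact: H.
Qed.

Lemma face_weight_lt u m m' : same_deg m m' -> face_monomial u m ->
  ~~ face_monomial u m' -> mweight u m < mweight u m'.
Proof.
move=> mm' /subd_facesP[l lL ml]; have [_ H] := cell_weight lL mm' ml.
rewrite ltNge; apply: contra => /H m'l.
by apply/subd_facesP; exists l.
Qed.

Lemma face_weight u m m' : same_deg m m' -> face_monomial u m ->
  face_monomial u m' -> mweight u m = mweight u m'.
Proof.
move=> mm' /subd_facesP[l lL ml] /subd_facesP[l' l'L ml'].
have m'm : same_deg m' m by move=> k kL; rewrite mm'.
by apply/le_anti; rewrite (cell_weight lL mm' ml).1 (cell_weight l'L m'm ml').1.
Qed.

Lemma mweightN w m : mweight (- w) m = - mweight w m.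
Proof. by rewrite -scaleN1r mweightZ mulN1r. Qed.

Lemma subd_idealE w p : subd_ideal I w p <->
  forall l, l \in L -> cell_ideal I (mincell (l - w)) p.
Proof.
rewrite /subd_ideal subd_lineality_config; split=> [H l lL|H _ [l lL <-]].
  by apply: H; exists l.
exact: H.
Qed.

Lemma cell_ideal_ideal D : is_ideal (cell_ideal I D).
Proof. exact: ideal_gen_ideal. Qed.

Lemma subd_ideal_ideal w : is_ideal (subd_ideal I w).
Proof.
split.
- by move=> D _; have [] := cell_ideal_ideal D.
- move=> p q Ip Iq D DD; have [_ JD _] := cell_ideal_ideal D.
  by apply: JD; [exact: Ip|exact: Iq].
by move=> a p Ip D DD; have [_ _ JM] := cell_ideal_ideal D; apply: JM; exact: Ip.
Qed.

Lemma cell_ideal_off D p :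
  monomials_in (fun m => ~~ (msupport m \subset D)) p -> cell_ideal I D p.
Proof.
apply: mpoly_off_ideal; first exact: cell_ideal_ideal.
by move=> e eD; apply: sub_gen_smallest; right; exists e.
Qed.

Lemma nonface_subd_ideal w m : ~~ face_monomial (- w) m -> subd_ideal I w 'X_[m].
Proof.
move=> nm; apply/subd_idealE => l lL; apply: cell_ideal_off => m'.
rewrite msuppX inE => /eqP->; apply: contra nm => ml.
by apply/subd_facesP; exists l.
Qed.

(** Fix a cell [D] and a degree. If that component of [p] is supported on [D], its weights agree and
    it survives whole in the initial form. Otherwise some monomial off [D] has smaller weight than
    all those on [D], so the initial form has only terms off [D]. *)
Lemma initial_sub_subd_ideal w : initial_ideal w I `<=` subd_ideal I w.
Proof.
apply: smallest_sub => [|_ [p Ip <-]]; first exact: subd_ideal_ideal.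
apply/subd_idealE => l lL; set D := mincell _.
apply: ideal_degcomps => [|m]; first exact: cell_ideal_ideal.
rewrite mcoeff_msupp initialE; case: ifP => [/allP mmin m0|]; last by rewrite eqxx.
set q := degcomp m (initial w p).
have Ip' := degcomp_mem m Ip.
have [/allP offD|/allPn[m1 m1p]] :=
    boolP (all (fun m => msupport m \subset D) (msupp (degcomp m p))).
  have -> : q = degcomp m p.
    apply/mpolyP => m'; rewrite !degcompE initialE; case: asboolP => // m'm.
    case: ifP => // /negP nmin; have [->//|m'p] := eqVneq p@_m' 0.
    case: nmin; apply/allP => m2 m2p.
    have mD : msupport m \subset D.
      by apply: offD; rewrite mcoeff_msupp degcompE asboolT.
    have [+ _] := cell_weight lL (same_deg_sym m'm) mD; rewrite !mweightN lerN2 => m'w.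
    exact: le_trans m'w (mmin _ m2p).
  apply: sub_gen_smallest; left; split=> // m' /offD/fintype.subsetP m'D e eD.
  by apply/eqP; apply: contraNT eD => me; apply: m'D; rewrite inE.
move=> m1D; have [m1m m1p'] := msupp_degcomp m1p.
apply: cell_ideal_off => m' /msupp_degcomp[m'm]; rewrite mcoeff_msupp initialE.
case: ifP => [/allP m'min _|]; last by rewrite eqxx.
apply: contra m1D => m'D.
have [_] := cell_weight lL (same_deg_trans m'm (same_deg_sym m1m)) m'D; apply.
by rewrite !mweightN lerN2 m'min.
Qed.

Lemma mwcompMX w c p m :
  mwcomp w c (p * 'X_[m]) = mwcomp w (c - mweight w m) p * 'X_[m].
Proof.
apply/mpolyP => k; rewrite mwcompE.
have [[k' ->]|nk] := pselect (exists k', k = (m + k')%MM).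
  rewrite !mcoeffMX mwcompE; congr (if _ then _ else _).
  by rewrite !mweight_dot mvecD dotDr eq_sym [RHS]eq_sym subr_eq addrC.
have coef0 q : (q * 'X_[m])@_k = 0.
  apply: memN_msupp_eq0; rewrite (perm_mem (msuppMX _ _)).
  by apply/mapP => -[k' _ kE]; apply: nk; exists k'.
by rewrite !coef0 if_same.
Qed.

(** Treating every weight [c] at once makes the property stable under sums and under multiplication
    by monomials, which only shift [c]. *)
Lemma initial_ideal_lift w p : initial_ideal w I p -> forall c, exists2 f, I f &
  monomials_in (fun m => c < mweight w m) (f - mwcomp w c p).
Proof.
have [I0 ID IM] := Iid; move: p; apply: smallest_sub; last first.
  move=> _ [p Ip <-] c.
  have [p0|/(initial_mwcomp w)[m mp inE]] := eqVneq p 0.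
    exists 0 => //; rewrite (_ : mwcomp _ _ _ = 0) ?subr0; first exact: monomials_in0.
    by apply/mpolyP => m; rewrite mwcompE initialE p0 !mcoeff0 !if_same.
  have inP m' : m' \in msupp (initial w p) -> mweight w m' = mweight w m.
    rewrite inE mcoeff_msupp mwcompE.
    by have [//|_] := eqVneq (mweight w m'); rewrite eqxx.
  have m_in : m \in msupp (initial w p).
    by rewrite inE mcoeff_msupp mwcompE eqxx -mcoeff_msupp.
  have mmin m' : m' \in msupp p -> mweight w m <= mweight w m'.
    move: m_in; rewrite mcoeff_msupp initialE.
    by case: ifP => [/allP H _|]; [exact: H | rewrite eqxx].
  have [->|cm] := eqVneq c (mweight w m).
    exists p => // m'; rewrite mcoeff_msupp mcoeffB mwcompE inE mwcompE.
    have [_|nm] := eqVneq (mweight w m'); first by rewrite subrr eqxx.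
    by rewrite subr0 -mcoeff_msupp lt_neqAle eq_sym nm => /mmin.
  exists 0 => //; rewrite (_ : mwcomp _ _ _ = 0) ?subr0; first exact: monomials_in0.
  apply/mpolyP => m'; rewrite mwcompE inE mwcompE mcoeff0.
  by have [m'c|//] := eqVneq (mweight w m') c; rewrite m'c (negPf cm).
have mwcompD c p q : mwcomp w c (p + q) = mwcomp w c p + mwcomp w c q.
  by apply/mpolyP => m; rewrite mcoeffD !mwcompE mcoeffD; case: ifP; rewrite ?addr0.
have mwcompZ c k p : mwcomp w c (k *: p) = k *: mwcomp w c p.
  by apply/mpolyP => m; rewrite mcoeffZ !mwcompE mcoeffZ; case: ifP; rewrite ?mulr0.
have mwcomp0 c : mwcomp w c 0 = 0.
  by rewrite -(scale0r 0) mwcompZ !scale0r.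
split.
- by move=> c; exists 0 => //; rewrite mwcomp0 subr0; exact: monomials_in0.
- move=> p q Jp Jq c; have [f If fp] := Jp c; have [g Ig gq] := Jq c.
  exists (f + g); first exact: ID.
  by rewrite mwcompD opprD addrACA; exact: monomials_inD.
move=> a p Jp c; rewrite [a]mpolyE mulr_suml.
elim: (msupp a) => [|m r [f If fr]].
  by exists 0 => //; rewrite big_nil mwcomp0 subr0; exact: monomials_in0.
have [g Ig gp] := Jp (c - mweight w m).
exists (a@_m *: (g * 'X_[m]) + f).
  by apply: ID => //; rewrite scalerAr mulrC; exact: IM.
rewrite big_cons mwcompD opprD addrACA; apply: monomials_inD => //.
rewrite -scalerAl [_ * p]mulrC mwcompZ mwcompMX -scalerBr -mulrBl.
apply: monomials_inZ => k; rewrite (perm_mem (msuppMX _ _)) => /mapP[k' /gp + ->].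
by rewrite ltrBlDl !mweight_dot mvecD dotDr.
Qed.

Lemma monomial_initial_lift w m : initial_ideal w I 'X_[m] -> exists2 f, I f &
  monomials_in (fun m' => same_deg m' m /\ mweight w m < mweight w m') ('X_[m] - f).
Proof.
move=> /initial_ideal_lift/(_ (mweight w m))[f If fm].
exists (degcomp m f); first exact: degcomp_mem.
move=> m'; rewrite mcoeff_msupp mcoeffB degcompE mcoeffX.
have [<-|mm'] := eqVneq m m'.
  rewrite asboolT // => m0; have : m \in msupp (f - mwcomp w (mweight w m) 'X_[m]).
    by rewrite mcoeff_msupp mcoeffB mwcompE eqxx mcoeffX eqxx -oppr_eq0 opprB.
  by move/fm; rewrite ltxx.
case: asboolP => [m'm|]; last by rewrite subrr eqxx.
rewrite sub0r oppr_eq0 => fm'; split=> //; apply: fm.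
by rewrite mcoeff_msupp mcoeffB mwcompE mcoeffX (negPf mm') if_same subr0.
Qed.

Lemma nonface_reduction w m :
  (forall m, ~~ face_monomial (- w) m -> initial_ideal w I 'X_[m]) ->
  exists2 g, I ('X_[m] - g) &
    monomials_in (fun m' => same_deg m' m /\ face_monomial (- w) m') g.
Proof.
have [I0 ID IM] := Iid => Iw; move md : (mdeg m) => d.
(* Rewriting raises the weight and keeps the total degree [d], so the number of heavier monomials of
   degree at most [d] drops. *)
have [k] := ubnP #|[set m' : 'X_{1..n < d.+1} | mweight w m < mweight w m']%SET|.
elim: k m md => // k IH m md; rewrite ltnS => mk.
have [fm|/Iw/monomial_initial_lift[f If]] := boolP (face_monomial (- w) m).
  exists 'X_[m]; rewrite ?subrr // => m'; rewrite msuppX inE => /eqP->.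
  by split.
set r := 'X_[m] - f => fm.
have [g Ig gm] : exists2 g, I (r - g) &
    monomials_in (fun m' => same_deg m' m /\ face_monomial (- w) m') g.
  rewrite [r]mpolyE; elim: (msupp r) (fm : {in msupp r, forall m', _}) => [_|m1 s IHs] /=.
    by exists 0; [rewrite big_nil subrr | exact: monomials_in0].
  move=> H; have [m' m's|g Ig gm] := IHs; first by apply: H; rewrite inE m's orbT.
  have [m1m wm1] := H m1 (mem_head _ _).
  have m1d : mdeg m1 = d by rewrite (same_deg_mdeg m1m).
  have [|g1 Ig1 g1m] := IH _ m1d.
    apply: leq_trans mk; apply/proper_card/properP; split.
      by apply/fintype.subsetP => m'; rewrite !inE; exact: lt_trans.
    have m1b : (mdeg m1 < d.+1)%N by rewrite m1d.
    by exists (BMultinom m1b); rewrite inE //= ltxx.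
  exists (r@_m1 *: g1 + g).
    rewrite big_cons opprD addrACA -scalerBr -mul_mpolyC.
    by apply: ID => //; exact: IM.
  apply: monomials_inD => //; apply: monomials_inZ => m' /g1m[m'm1 m'f].
  by split=> //; exact: same_deg_trans m1m.
exists g => //; have -> : 'X_[m] - g = f + (r - g) by rewrite /r; ring.
exact: ID.
Qed.

Lemma Omega_star_coarser w w' : Omega_star I w ->
  coarser L (- w) (- w') -> Omega_star I w'.
Proof.
move=> Ow ww'.
have [I0 ID IM] := Iid.
have Iw m : ~~ face_monomial (- w) m -> initial_ideal w I 'X_[m].
  by move=> /nonface_subd_ideal; rewrite Ow.
have Iw' m : ~~ face_monomial (- w') m -> initial_ideal w' I 'X_[m].
  move=> nm; have [g Ig gm] := nonface_reduction m Iw.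
  apply: sub_gen_smallest; exists ('X_[m] - g) => //.
  (* Faces for [- w] are faces for [- w'], so the terms of [g] are heavier than the nonface monomial
     [m], which is thus the initial form of the relation. *)
  have mg m' : m' \in msupp g -> mweight w' m < mweight w' m'.
    move=> /gm[m'm m'f]; rewrite -ltrN2 -!mweightN.
    by apply: face_weight_lt => //; exact: (fintype.subsetP ww').
  have gm0 : g@_m = 0.
    by apply: memN_msupp_eq0; apply/negP => /mg; rewrite ltxx.
  have mE : m \in msupp ('X_[m] - g).
    by rewrite mcoeff_msupp mcoeffB mcoeffX eqxx gm0 subr0 oner_eq0.
  apply/mpolyP => m'; rewrite initialE mcoeffB mcoeffX.
  have [<-|mm'] := eqVneq m m'.
    rewrite gm0 subr0; case: ifP => // /negP[]; apply/allP => m1 /=.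
    rewrite mcoeff_msupp mcoeffB mcoeffX; have [<-//|mm1] := eqVneq m m1.
    by rewrite sub0r oppr_eq0 -mcoeff_msupp => /mg/ltW.
  case: ifP => // /allP/(_ _ mE) /= m'min; rewrite sub0r.
  have [->|] := eqVneq g@_m' 0; first by rewrite oppr0.
  by rewrite -mcoeff_msupp => /mg; rewrite ltNge m'min.
apply/seteqP; split; last exact: initial_sub_subd_ideal.
have Jid : is_ideal (initial_ideal w' I) by exact: ideal_gen_ideal.
have [J0 JD JM] := Jid.
move=> p Sp.
pose q : S := \sum_(m <- msupp p | face_monomial (- w') m) p@_m *: 'X_[m].
have qE m : q@_m = if face_monomial (- w') m then p@_m else 0.
  exact: (mcoeff_filter (face_monomial (- w'))).
have Jpq : initial_ideal w' I (p - q).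
  rewrite [p - q]mpolyE; apply: ideal_sum => // m.
  rewrite mcoeff_msupp mcoeffB qE; case: ifP => [|/negbT nm _].
    by rewrite subrr eqxx.
  by rewrite -mul_mpolyC; apply: JM; exact: Iw'.
rewrite -(subrK q p); apply: JD => //.
have Sq : subd_ideal I w' q.
  have [_ SD SM] := subd_ideal_ideal w'.
  have -> : q = p + (-1) * (p - q) by ring.
  by apply: SD => //; apply: SM; exact: initial_sub_subd_ideal.
apply: ideal_degcomps => // m; rewrite mcoeff_msupp qE.
case: ifP => [fm _|]; last by rewrite eqxx.
have /subd_facesP[l lL ml] := fm.
(* In the degree of [m] all face monomials lie in this one cell, so the components of [q] and of [r]
   agree there. That component lies in [I] and has a single [w']-weight, so it is its own initial
   form. *)
have [r [Ir rD rqD]] := cell_ideal_split ((subd_idealE _ _).1 Sq _ lL).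
have qrE : degcomp m q = degcomp m r.
  apply/mpolyP => m'; rewrite !degcompE; case: asboolP => // m'm.
  have [m'D|m'D] := boolP (msupport m' \subset mincell (l - w')).
    apply/eqP; rewrite -subr_eq0 -mcoeffB; apply: contraLR m'D.
    by rewrite -mcoeff_msupp => /rqD.
  have -> : r@_m' = 0.
    by apply: memN_msupp_eq0; apply: contra m'D => /rD.
  rewrite qE; case: ifP => // m'f; case/negP: m'D.
  have mm' := same_deg_sym m'm.
  by have [_] := cell_weight lL mm' ml; apply; rewrite (face_weight mm' fm m'f).
apply: sub_gen_smallest; exists (degcomp m q).
  by rewrite qrE; exact: degcomp_mem.
apply/mpolyP => m'; rewrite initialE; case: ifP => // /negbT/allPn[m2 m2q].
have [m2m] := msupp_degcomp m2q; rewrite mcoeff_msupp qE.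
case: ifP => [m2f _|]; last by rewrite eqxx.
rewrite degcompE qE; case: asboolP => // m'm; case: ifP => // m'f /negP[].
rewrite -lerN2 -!mweightN.
by rewrite (face_weight (same_deg_trans m'm (same_deg_sym m2m)) m'f m2f).
Qed.

End InitialDegenerations.

(** * The standard grading and the resulting fan *)

Lemma lineality_const1 (R : realType) (n : nat) (I : set {mpoly R[i][n]}) :
  is_ideal I -> std_homogeneous I -> lineality I (const_mx 1).
Proof.
move=> Iid Ih; apply/linealityE => // p Ip c.
have [[d ->]|nd] := pselect (exists d : nat, c = d%:R).
  suff -> : mwcomp (const_mx 1) d%:R p = pihomog mdeg d p by exact: Ih.
  by apply: eq_bigl => m; rewrite mweight_mdeg eqr_nat.
have -> : mwcomp (const_mx 1) c p = 0; last by case: Iid.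
apply: big_pred0 => m; rewrite mweight_mdeg; apply/eqP => mc.
by apply: nd; exists (mdeg m).
Qed.

Theorem theorem5p8 (R : realType) (n : nat) (I : set {mpoly R[i][n]}) :
  is_ideal I ->
  std_homogeneous I ->
  ~ (irrelevant_ideal R[i] n `<=` I) ->
  exists2 Phi : set (set 'rV[R]_n),
    subfan Phi (opp_fan (secondary_fan (lineality_config I))) &
    Omega_star I = fan_support Phi.
Proof.
move=> Iid Ih Iirr.
(* Without variables the irrelevant ideal has no generators and lies in [I]. *)
have n_gt0 : (0 < n)%N.
  rewrite ltnNge; apply: contra_notN Iirr => n0; apply: smallest_sub => // _ [e _ <-].
  by have := leq_trans (ltn_ord e) n0.
pose L := lineality_vspace I.
have L1 : const_mx 1 \in L by apply/mem_lineality_vspace/lineality_const1.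
(* Subdivisions are induced by [- w], so the fan is built on the reflected set and then reflected
   back. *)
pose O := [set u : 'rV[R]_n | Omega_star I (- u)].
have OC u : O u -> coarser L u `<=` O.
  move=> Ou v uv; apply: (Omega_star_coarser Iid n_gt0 L1 Ou).
  by rewrite !opprK.
exists (opp_fan [set coarser L u | u in O]).
  split; last exact/fan_opp/coarser_fan.
  move=> _ [_ [u _ <-] <-]; exists (coarser L u) => //.
  exists (subd (lineality_config I) u); first by exists u.
  rewrite -closure_cells // /secondary_cone; congr closure.
  by apply/funext => v /=; rewrite !subd_lineality_config.
apply/seteqP; split=> [w Ow|w [_ [_ [u Ou <-] <-]]].
  exists (-%R @` coarser L (- w)); last by rewrite oppimageE; exact: coarser_refl.
  by exists (coarser L (- w)) => //; exists (- w); rewrite // /O /= opprK.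
by rewrite oppimageE => /= uw; have := OC u Ou _ uw; rewrite /O /= opprK.
Qed.
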